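(* Let $T>0$, let $H:[0,T]\times\mathbb{R}^n\times\mathbb{R}^n\to\mathbb{R}$ and $h:\mathbb{R}^n\to\mathbb{R}$ be continuous, and suppose there are constants $K_0>0$, $\mu\ge1$ and $\lambda_i,\nu_i\ge0$ $(i=1,2,\dots,k)$ with $$\lambda_i+(\mu-1)\nu_i\le1,\qquad1\le i\le k,$$ and a continuous function $\omega:[0,\infty)^3\to[0,\infty)$ with $\omega(r,s,0)=0$ for all $r,s\geq 0$, such that $$|H(t,x,p)-H(t,y,p)|\le\omega\big(|x|+|y|,|p|,|x-y|\big),\qquad\forall t\in[0,T],\ x,y,p\in\mathbb{R}^n,$$ $$|H(t,x,p)-H(t,x,q)|\le K_0\sum_{i=1}^k\langle x\rangle^{\lambda_i}\big(|p|\vee|q|\big)^{\nu_i}|p-q|,\qquad\forall t\in[0,T],\ x,p,q\in\mathbb{R}^n,$$ $$|h(x)-h(y)|\le K_0\big(\langle x\rangle\vee\langle y\rangle\big)^{\mu-1}|x-y|,\qquad\forall x,y\in\mathbb{R}^n.$$ Let $V,\hat V:[0,T]\times\mathbb{R}^n\to\mathbb{R}$ be, respectively, a viscosity sub-solution and a viscosity super-solution of the Hamilton–Jacobi equation $V_t+H(t,x,V_x)=0$ on $[0,T]\times\mathbb{R}^n$ with terminal data $V(T,x)=h(x)$. Moreover, suppose that for some $K>0$, $$|V(t,x)-V(t,y)|,\ |\hat V(t,x)-\hat V(t,y)|\le K\big(\langle x\rangle\vee\langle y\rangle\big)^{\mu-1}|x-y|,\qquad\forall t\in[0,T],\ x,y\in\mathbb{R}^n.$$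 Then $$V(t,x)\le\hat V(t,x),\qquad\forall(t,x)\in[0,T]\times\mathbb{R}^n.$$
   Context: $\langle x\rangle=\sqrt{1+|x|^2}$ and $a\vee b=\max\{a,b\}$. A continuous function $V:[0,T]\times\mathbb{R}^n\to\mathbb{R}$ is a viscosity sub-solution if $V(T,x)\le h(x)$ for all $x\in\mathbb{R}^n$ and, for any continuously differentiable function $\varphi$, whenever $(t_0,x_0)\in[0,T)\times\mathbb{R}^n$ is a local maximum of $(t,x)\mapsto V(t,x)-\varphi(t,x)$ on $[0,T]\times\mathbb{R}^n$, one has $\varphi_t(t_0,x_0)+H(t_0,x_0,\varphi_x(t_0,x_0))\ge0$. A continuous function $V:[0,T]\times\mathbb{R}^n\to\mathbb{R}$ is a viscosity super-solution if $V(T,x)\ge h(x)$ for all $x\in\mathbb{R}^n$ and, for any continuously differentiable function $\varphi$, whenever $(t_0,x_0)\in[0,T)\times\mathbb{R}^n$ is a local minimum of $(t,x)\mapsto V(t,x)-\varphi(t,x)$ on $[0,T]\times\mathbb{R}^n$, one has $\varphi_t(t_0,x_0)+H(t_0,x_0,\varphi_x(t_0,x_0))\le0$. *)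

(* Defs.v *)
From HB Require Import structures.
From mathcomp Require Import all_boot all_order all_algebra.
From mathcomp Require Import all_classical all_reals all_analysis.

Set Implicit Arguments.
Unset Strict Implicit.
Unset Printing Implicit Defensive.
Import Order.TTheory GRing.Theory Num.Theory.
Import numFieldNormedType.Exports.
Local Open Scope classical_set_scope.
Local Open Scope ring_scope.

(* The library norm on 'rV[R]_n is the sup norm, hence this definition; both
   norms induce the same topology. *)
Definition enorm (R : realType) (n : nat) (x : 'rV[R]_n) : R :=
  Num.sqrt (\sum_(i < n) x ord0 i ^+ 2).

Definition jbracket (R : realType) (n : nat) (x : 'rV[R]_n) : R :=
  Num.sqrt (1 + enorm x ^+ 2).

Definition strip (R : realType) (n : nat) (T : R) : set (R * 'rV[R]_n) :=
  `[0, T]%classic `*` setT.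

Definition C1 (R : realType) (n : nat) (phi : R * 'rV[R]_n -> R) : Prop :=
  (forall z, differentiable phi z) /\ (forall v, continuous ('D_v phi)).

Definition partial_t (R : realType) (n : nat) (phi : R * 'rV[R]_n -> R)
    (t : R) (x : 'rV[R]_n) : R :=
  'D_(1 : R, 0 : 'rV[R]_n) phi (t, x).

Definition gradient_x (R : realType) (n : nat) (phi : R * 'rV[R]_n -> R)
    (t : R) (x : 'rV[R]_n) : 'rV[R]_n :=
  \row_(i < n) 'D_(0 : R, delta_mx ord0 i : 'rV[R]_n) phi (t, x).

Definition local_max_on (R : realType) (n : nat) (A : set (R * 'rV[R]_n))
    (f : R * 'rV[R]_n -> R) (z0 : R * 'rV[R]_n) : Prop :=
  A z0 /\ \forall z \near within A (nbhs z0), f z <= f z0.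

Definition local_min_on (R : realType) (n : nat) (A : set (R * 'rV[R]_n))
    (f : R * 'rV[R]_n -> R) (z0 : R * 'rV[R]_n) : Prop :=
  A z0 /\ \forall z \near within A (nbhs z0), f z0 <= f z.

(* Functions on [0,T] x R^n are total functions of which only the values for
   t in [0,T] matter.  Test functions are C^1 on all of R x R^n: every C^1
   function on the closed strip extends to such a function, so no test
   function is lost, and the derivatives make sense at t0 = 0.  The extremum is
   still relative to the strip. *)
Definition viscosity_subsolution (R : realType) (n : nat) (T : R)
    (H : R -> 'rV[R]_n -> 'rV[R]_n -> R) (h : 'rV[R]_n -> R)
    (V : R -> 'rV[R]_n -> R) : Prop :=
  [/\ {within strip T, continuous (fun z : R * 'rV[R]_n => V z.1 z.2)},
      forall x, V T x <= h x
    & forall phi : R * 'rV[R]_n -> R, C1 phi ->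
      forall (t0 : R) (x0 : 'rV[R]_n), 0 <= t0 < T ->
      local_max_on (strip T) (fun z => V z.1 z.2 - phi z) (t0, x0) ->
      0 <= partial_t phi t0 x0 + H t0 x0 (gradient_x phi t0 x0)].

Definition viscosity_supersolution (R : realType) (n : nat) (T : R)
    (H : R -> 'rV[R]_n -> 'rV[R]_n -> R) (h : 'rV[R]_n -> R)
    (V : R -> 'rV[R]_n -> R) : Prop :=
  [/\ {within strip T, continuous (fun z : R * 'rV[R]_n => V z.1 z.2)},
      forall x, h x <= V T x
    & forall phi : R * 'rV[R]_n -> R, C1 phi ->
      forall (t0 : R) (x0 : 'rV[R]_n), 0 <= t0 < T ->
      local_min_on (strip T) (fun z => V z.1 z.2 - phi z) (t0, x0) ->
      partial_t phi t0 x0 + H t0 x0 (gradient_x phi t0 x0) <= 0].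

(* Main.v *)
Require Import Defs.
From HB Require Import structures.
From mathcomp Require Import all_boot all_order all_algebra.
From mathcomp Require Import all_classical all_reals all_analysis.
From mathcomp Require Import ring lra.

Set Implicit Arguments.
Unset Strict Implicit.
Unset Printing Implicit Defensive.
Import Order.TTheory GRing.Theory Num.Theory.
Import numFieldNormedType.Exports.
Local Open Scope classical_set_scope.
Local Open Scope ring_scope.

(* Suppose V > Vhat somewhere.  Both functions are O(<x>^mu), and gradients at
   touching points are O(<x>^(mu-1)), so the exponent condition makes H Lipschitz
   in p with constant C <x> at the relevant points.  The barrier
   psi = exp(c (T - t)) <x>^(2N), N >= mu, satisfies psi_t + C <x> |psi_x| <= - psi
   for c large, and V - al psi - Vhat has a positive maximum on a large ball,
   away from t = T and from the boundary of the ball.  Doubling the variables,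
   with penalty a (|t - s|^2 + |x - y|^2), gives p = 2a (x - y) and
     0 <= al psi_t + H(t, x, p + al psi_x) - H(s, y, p)
       <= - al psi + (H(t, x, p) - H(s, y, p)).
   The vector p is bounded independently of a, by comparing y with the
   competitor x in the minimum property of Vhat, so uniform continuity of H on
   compact sets makes the last difference smaller than al <= al psi. *)

(** * Continuously differentiable functions *)

Section has_C1_diff.
Variables (R : realType) (U : normedModType R).
Implicit Types (f g : U -> R) (df dg : U -> U -> R).

(** The differential is carried as an explicit function, so that derivatives of composite test
    functions come out as formulas; its continuity is asked direction by direction, as in [C1]. *)
Definition has_C1_diff f df :=
  (forall z, is_diff z f (df z)) /\ (forall v, continuous (df ^~ v)).

Lemma has_C1_diff_continuous f df : has_C1_diff f df -> continuous f.
Proof.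
by move=> [dff _] z; apply: differentiable_continuous; case: (dff z).
Qed.

Lemma has_C1_diff_derive f df z v : has_C1_diff f df -> 'D_v f z = df z v.
Proof. by move=> [dff _]; case: (dff z) => d e; rewrite deriveE// e. Qed.

Lemma eq_has_C1_diff f df df' :
  has_C1_diff f df -> (forall z v, df z v = df' z v) -> has_C1_diff f df'.
Proof.
by move=> fdf e; rewrite -(_ : df = df')//; apply/funext => z; apply/funext.
Qed.

Lemma has_C1_diff_cst (c : R) : has_C1_diff (cst c) (fun _ _ => 0).
Proof.
by split=> [z|v z]; [exact: is_diff_cst | exact: cst_continuous].
Qed.

Lemma has_C1_diff_linear (f : {linear U -> R}) :
  continuous f -> has_C1_diff f (fun _ => f).
Proof.
move=> cf; split=> [z|v z]; last exact: cst_continuous.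
by apply: DiffDef; [exact: linear_differentiable | exact: diff_lin].
Qed.

Lemma has_C1_diffD f g df dg : has_C1_diff f df -> has_C1_diff g dg ->
  has_C1_diff (fun z => f z + g z) (fun z v => df z v + dg z v).
Proof.
move=> [dff cf] [dgg cg]; split=> [z|v z]; first exact: (is_diffD (dff z) (dgg z)).
by apply: cvgD; [exact: cf | exact: cg].
Qed.

Lemma has_C1_diffM f g df dg : has_C1_diff f df -> has_C1_diff g dg ->
  has_C1_diff (fun z => f z * g z) (fun z v => f z * dg z v + g z * df z v).
Proof.
move=> fdf gdg; have [dff cf] := fdf; have [dgg cg] := gdg.
split=> [z|v z]; first exact: (is_diffM (dff z) (dgg z)).
apply: cvgD; apply: cvgM; [|exact: cg| |exact: cf].
- exact: (has_C1_diff_continuous fdf).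
- exact: (has_C1_diff_continuous gdg).
Qed.

Lemma has_C1_diffZ (c : R) f df : has_C1_diff f df ->
  has_C1_diff (fun z => c * f z) (fun z v => c * df z v).
Proof.
move=> fdf; apply: eq_has_C1_diff (has_C1_diffM (has_C1_diff_cst c) fdf) _.
by move=> z v; rewrite mulr0 addr0.
Qed.

Lemma has_C1_diffXn f df m : has_C1_diff f df ->
  has_C1_diff (fun z => f z ^+ m.+1) (fun z v => m.+1%:R * f z ^+ m * df z v).
Proof.
move=> fdf; elim: m => [|m IHm].
  by apply: eq_has_C1_diff fdf _ => z v; rewrite expr0 !mul1r.
under [f in has_C1_diff f]eq_fun do rewrite exprS.
apply: eq_has_C1_diff (has_C1_diffM fdf IHm) _ => z v.
by rewrite exprS -[m.+2]addn1 natrD; ring.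
Qed.

Lemma has_C1_diff_sum (I : Type) (r : seq I) (F : I -> U -> R)
    (dF : I -> U -> U -> R) : (forall i, has_C1_diff (F i) (dF i)) ->
  has_C1_diff (fun z => \sum_(i <- r) F i z)
              (fun z v => \sum_(i <- r) dF i z v).
Proof.
move=> FdF; elim: r => [|i r IHr].
  under eq_fun do rewrite big_nil.
  apply: eq_has_C1_diff (has_C1_diff_cst 0) _ => z v; by rewrite big_nil.
under eq_fun do rewrite big_cons.
by apply: eq_has_C1_diff (has_C1_diffD (FdF i) IHr) _ => z v; rewrite big_cons.
Qed.

Lemma has_C1_diff_expR f df : has_C1_diff f df ->
  has_C1_diff (fun z => expR (f z)) (fun z v => expR (f z) * df z v).
Proof.
move=> fdf; have [dff cf] := fdf.
split=> [z|v z].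
  have dexp : is_diff (f z) expR (fun h => h *: expR (f z)).
    have d : differentiable (@expR R) (f z).
      exact/derivable1_diffP/derivable_expR.
    by apply: DiffDef => //; rewrite diff1E// derive1E derive_val.
  have := is_diff_comp (dff z) dexp.
  rewrite (_ : _ \o df z = fun v => expR (f z) * df z v)//.
  by apply/funext => v /=; rewrite mulrC.
apply: cvgM; last exact: cf.
apply: continuous_comp; first exact: (has_C1_diff_continuous fdf).
exact: continuous_expR.
Qed.

End has_C1_diff.

(** * The Euclidean norm and the Japanese bracket *)

Section euclidean.
Variables (R : realType) (n : nat).
Implicit Types x y p : 'rV[R]_n.

(** The squared Euclidean norm is polynomial, hence smooth also at the origin, where [enorm] is not;
    penalty and barrier are built from it. *)
Definition sqn x : R := \sum_(i < n) x ord0 i ^+ 2.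

Lemma sqn_ge0 x : 0 <= sqn x.
Proof. by apply: sumr_ge0 => i _; exact: sqr_ge0. Qed.

Lemma enorm_sqr x : enorm x ^+ 2 = sqn x.
Proof. by rewrite sqr_sqrtr ?sqn_ge0. Qed.

Lemma enorm_ge0 x : 0 <= enorm x.
Proof. exact: sqrtr_ge0. Qed.

Lemma jbracket_sqr x : jbracket x ^+ 2 = 1 + sqn x.
Proof. by rewrite sqr_sqrtr enorm_sqr// addr_ge0// sqn_ge0. Qed.

Lemma jbracket_ge1 x : 1 <= jbracket x.
Proof.
rewrite -[leLHS]sqrtr1 ler_sqrt ?enorm_sqr ?lerDl ?sqn_ge0//.
by rewrite addr_ge0// sqn_ge0.
Qed.

Lemma jbracket_gt0 x : 0 < jbracket x.
Proof. exact: lt_le_trans (jbracket_ge1 x). Qed.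

Lemma jbracket_ge0 x : 0 <= jbracket x.
Proof. exact/ltW/jbracket_gt0. Qed.

Lemma enorm_le_jbracket x : enorm x <= jbracket x.
Proof.
rewrite -ler_sqr ?nnegrE ?enorm_ge0 ?jbracket_ge0// enorm_sqr jbracket_sqr.
by rewrite lerDr.
Qed.

Lemma jbracket0 : jbracket (0 : 'rV[R]_n) = 1.
Proof.
rewrite /jbracket enorm_sqr /sqn big1 ?addr0 ?sqrtr1// => i _.
by rewrite mxE expr0n.
Qed.

Lemma enorm0 : enorm (0 : 'rV[R]_n) = 0.
Proof.
apply/eqP; rewrite -sqrf_eq0 enorm_sqr /sqn big1// => i _.
by rewrite mxE expr0n.
Qed.

Lemma sqnZ a x : sqn (a *: x) = a ^+ 2 * sqn x.
Proof.
by rewrite /sqn mulr_sumr; apply: eq_bigr => i _; rewrite mxE exprMn.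
Qed.

Lemma enormZ a x : enorm (a *: x) = `|a| * enorm x.
Proof. by rewrite /enorm -/(sqn _) sqnZ sqrtrM ?sqr_ge0// sqrtr_sqr. Qed.

Lemma sqnC x y : sqn (x - y) = sqn (y - x).
Proof. by apply: eq_bigr => i _; rewrite !mxE; ring. Qed.

Lemma enormC x y : enorm (x - y) = enorm (y - x).
Proof. by rewrite /enorm -/(sqn _) sqnC. Qed.

(** From |y|^2 <= 2|x|^2 + 2|x - y|^2 one gets 1 + |y|^2 <= 3 + 2|x|^2 <= 4(1 + |x|^2). *)
Lemma jbracket_near x y : enorm (x - y) <= 1 -> jbracket y <= 2 * jbracket x.
Proof.
move=> xy1; have sxy : sqn (x - y) <= 1.
  by rewrite -enorm_sqr expr_le1// enorm_ge0.
have sy : sqn y <= 2 * sqn x + 2 * sqn (x - y).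
  rewrite /sqn !mulr_sumr -big_split; apply: ler_sum => i _ /=.
  rewrite !mxE; set a := x _ _; set b := y _ _.
  by have := sqr_ge0 (b - 2 * a); nra.
rewrite -ler_sqr ?nnegrE ?mulr_ge0 ?jbracket_ge0// exprMn !jbracket_sqr.
have := sqn_ge0 x; lra.
Qed.

Lemma coord_le_enorm x i : `|x ord0 i| <= enorm x.
Proof.
rewrite -ler_sqr ?nnegrE ?enorm_ge0// enorm_sqr real_normK ?num_real//.
by rewrite /sqn (bigD1 i)//= lerDl sumr_ge0// => j _; exact: sqr_ge0.
Qed.

Lemma norm_le_enorm x : `|x| <= enorm x.
Proof.
rewrite [leLHS]/Num.norm/= mx_normrE; apply/bigmax_leP; split=> [|[i j] _ /=].
  exact: enorm_ge0.
by rewrite ord1; exact: coord_le_enorm.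
Qed.

Lemma continuous_sqn : continuous sqn.
Proof.
apply: continuous_big => [|i _ x]; first exact: add_continuous.
apply: (@continuous_comp _ _ _ (fun y : 'rV[R]_n => y ord0 i) (fun r => r ^+ 2)).
  exact: coord_continuous.
exact: exprn_continuous.
Qed.

Lemma continuous_enorm : continuous (@enorm R n).
Proof.
move=> x; apply: (@continuous_comp _ _ _ sqn Num.sqrt); first exact: continuous_sqn.
exact: sqrt_continuous.
Qed.

Lemma compact_eball r : compact [set x : 'rV[R]_n | enorm x <= r].
Proof.
apply: bounded_closed_compact.
  exists r; split=> [|M rM x /= xr]; first exact: num_real.
  by rewrite (le_trans (norm_le_enorm x))// (le_trans xr)// ltW.
rewrite (_ : [set _ | _] = @enorm R n @^-1` [set t | t <= r])//.
by apply: closed_comp => [x _|]; [exact: continuous_enorm | exact: closed_le].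
Qed.

End euclidean.

(** Only [z] is confined to [A], since [f] is continuous everywhere. Each point of [A] has a ball on
    which [f] varies by less than [e / 2]; with half its radius for [z] and less than half for [d],
    both [z] and [w] stay in it, and compactness makes [d] uniform. *)
Lemma compact_uniform_continuous (R : realType) (U : pseudoMetricType R)
    (f : U -> R) (A : set U) (e : R) :
  compact A -> continuous f -> 0 < e ->
  exists2 d, 0 < d & forall z w, A z -> ball z d w -> `|f z - f w| < e.
Proof.
move=> /compact_near_coveringP cA cf e0.
have := cA R (at_right (0 : R)) (fun d z => forall w, ball z d w -> `|f z - f w| < e).
move=> /(_ _) []//.
  move=> z Az.
  have e20 : 0 < e / 2 by rewrite divr_gt0.
  have /cvgrPdist_lt /(_ _ e20) /nbhs_ballP[r /= r0 rz] := cf z.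
  have r20 : 0 < r / 2 by rewrite divr_gt0.
  exists (ball z (r / 2), [set d | 0 < d < r / 2]).
    split; first exact: nbhsx_ballx.
    near=> d; apply/andP; split; near: d; [exact: nbhs_right_gt | exact: nbhs_right_lt].
  move=> [z' d] /= [zz' /andP[d0 dr]] w z'w.
  have zw : ball z r w.
    by rewrite [r]splitr; apply: ball_triangle zz' _; apply: le_ball z'w; exact: ltW.
  have zz'r : ball z r z' by apply: le_ball zz'; rewrite ler_pdivrMr// ler_peMr ?ltW// ltr1n.
  have := rz _ zw; have := rz _ zz'r => /= h1 h2.
  rewrite (_ : f z' - f w = (f z - f w) - (f z - f z')); last by ring.
  by rewrite (le_lt_trans (ler_normB _ _))// [e]splitr ltrD.
move=> d /= d0 H; exists (d / 2); first by rewrite divr_gt0.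
move=> z w Az zw; apply: (H (d/2)) => //=; last by rewrite divr_gt0.
by rewrite sub0r normrN ger0_norm ?divr_ge0 ?ltW// ltr_pdivrMr// ltr_pMr// ltr1n.
Unshelve. all: end_near. Qed.

(** * Test functions and barrier *)

Section test_functions.
Variables (R : realType) (n : nat).
Local Notation E := (R * 'rV[R]_n)%type.
Implicit Types (x y p q : 'rV[R]_n) (z v : E).

Definition dotv p x : R := \sum_(i < n) p ord0 i * x ord0 i.

Lemma dotvv p : dotv p p = sqn p.
Proof. by apply: eq_bigr => i _; rewrite expr2. Qed.

Lemma dotvN p q : dotv p (- q) = - dotv p q.
Proof. by rewrite /dotv -sumrN; apply: eq_bigr => i _; rewrite mxE mulrN. Qed.

Lemma dotvD p q x : dotv (p + q) x = dotv p x + dotv q x.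
Proof. by rewrite /dotv -big_split; apply: eq_bigr => i _; rewrite mxE mulrDl. Qed.

Lemma dotvZ a p x : dotv (a *: p) x = a * dotv p x.
Proof. by rewrite /dotv mulr_sumr; apply: eq_bigr => i _; rewrite mxE mulrA. Qed.

(** The linear form on R x R^n with time coefficient [a] and space coefficient [p]. A differential
    written this way shows the time derivative and the space gradient at once. *)
Definition pairing (a : R) p v : R := a * v.1 + dotv p v.2.

Lemma has_C1_diff_C1 (phi : E -> R) dphi : has_C1_diff phi dphi -> C1 phi.
Proof.
move=> phid; split=> [z|v]; first by case: phid => /(_ z) [].
rewrite (_ : 'D_v phi = dphi ^~ v); first by case: phid.
by apply/funext => z; exact: has_C1_diff_derive.
Qed.

Lemma partial_t_pairing (phi : E -> R) (a : E -> R) (p : E -> 'rV[R]_n) t x :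
  has_C1_diff phi (fun z => pairing (a z) (p z)) -> partial_t phi t x = a (t, x).
Proof.
move=> phid; rewrite /partial_t (has_C1_diff_derive _ _ phid) /pairing/= mulr1.
by rewrite /dotv big1 ?addr0// => i _; rewrite mxE mulr0.
Qed.

Lemma gradient_x_pairing (phi : E -> R) (a : E -> R) (p : E -> 'rV[R]_n) t x :
  has_C1_diff phi (fun z => pairing (a z) (p z)) ->
  gradient_x phi t x = p (t, x).
Proof.
move=> phid; apply/rowP => i; rewrite mxE (has_C1_diff_derive _ _ phid).
rewrite /pairing/= mulr0 add0r /dotv (bigD1 i)//= mxE !eqxx mulr1.
by rewrite big1 ?addr0// => j ji; rewrite mxE eqxx (negbTE ji) mulr0.
Qed.

Lemma has_C1_diff_fst : has_C1_diff (fun z => z.1) (fun _ v => v.1).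
Proof.
apply: (@has_C1_diff_linear _ _ (@fst R 'rV[R]_n)) => z; exact: cvg_fst.
Qed.

Lemma has_C1_diff_coord i :
  has_C1_diff (fun z => z.2 ord0 i) (fun _ v => v.2 ord0 i).
Proof.
have lf : linear (fun z : E => z.2 ord0 i : R) by move=> a u v /=; rewrite !mxE.
pose fM := GRing.isLinear.Build _ _ _ _ _ lf.
pose f : {linear E -> R} := HB.pack (fun z : E => z.2 ord0 i : R) fM.
apply: (@has_C1_diff_linear _ _ f) => z.
apply: (@continuous_comp _ _ _ snd (fun y : 'rV[R]_n => y ord0 i)).
  exact: cvg_snd.
exact: coord_continuous.
Qed.

Lemma has_C1_diff_sqn y :
  has_C1_diff (fun z => sqn (z.2 - y)) (fun z v => dotv (2 *: (z.2 - y)) v.2).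
Proof.
have h i : has_C1_diff (fun z => (z.2 ord0 i + (- y ord0 i)) ^+ 2)
    (fun z v => 2 * (z.2 ord0 i - y ord0 i) * v.2 ord0 i).
  apply: eq_has_C1_diff; first exact: (has_C1_diffXn 1
    (has_C1_diffD (has_C1_diff_coord i) (has_C1_diff_cst _ (- y ord0 i)))).
  by move=> z v; rewrite /= addr0 expr1.
rewrite (_ : (fun z : E => _) =
    fun z => \sum_(i < n) (z.2 ord0 i + (- y ord0 i)) ^+ 2).
  apply: eq_has_C1_diff (has_C1_diff_sum _ h) _ => z v.
  by apply: eq_bigr => i _; rewrite !mxE.
by apply/funext => z; apply: eq_bigr => i _; rewrite !mxE.
Qed.

Definition sqdist (s : R) y z : R := (z.1 - s) ^+ 2 + sqn (z.2 - y).

Lemma has_C1_diff_sqdist s y : has_C1_diff (sqdist s y)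
  (fun z => pairing (2 * (z.1 - s)) (2 *: (z.2 - y))).
Proof.
have ds := has_C1_diffXn 1 (has_C1_diffD has_C1_diff_fst (has_C1_diff_cst _ (- s))).
apply: eq_has_C1_diff (has_C1_diffD ds (has_C1_diff_sqn y)) _.
by move=> z v; rewrite /= addr0 expr1.
Qed.

(** This is exp(c(T - t)) <x>^(2N) with N = m + 1; the even power keeps it smooth. *)
Definition barrier (c T : R) (m : nat) z : R :=
  expR (c * (T - z.1)) * (1 + sqn z.2) ^+ m.+1.

Definition dbarrier (c T : R) (m : nat) z : 'rV[R]_n :=
  (expR (c * (T - z.1)) * (m.+1%:R * (1 + sqn z.2) ^+ m * 2)) *: z.2.

Lemma has_C1_diff_barrier c T m : has_C1_diff (barrier c T m)
  (fun z => pairing (- c * barrier c T m z) (dbarrier c T m z)).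
Proof.
apply: eq_has_C1_diff.
  apply: has_C1_diffM.
    apply: has_C1_diff_expR; apply: has_C1_diffZ; apply: has_C1_diffD.
      exact: has_C1_diff_cst.
    rewrite (_ : (fun z : E => - z.1) = fun z => (- 1) * z.1).
      exact: has_C1_diffZ has_C1_diff_fst.
    by apply/funext => z; rewrite mulN1r.
  apply: has_C1_diffXn; apply: has_C1_diffD; first exact: has_C1_diff_cst.
  under eq_fun do rewrite -[_.2]subr0.
  exact: has_C1_diff_sqn.
move=> z v; rewrite /pairing /dbarrier /barrier subr0 !dotvZ.
ring.
Qed.

Lemma barrier_ge1 c T m z : 0 <= c -> z.1 <= T -> 1 <= barrier c T m z.
Proof.
move=> c0 zT; rewrite /barrier -[leLHS]mulr1 ler_pM//.
  by rewrite -[leLHS]expR0 ler_expR mulr_ge0 ?subr_ge0.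
by rewrite exprn_ege1// lerDl sqn_ge0.
Qed.

(* The barrier turns the linear growth in [x] of the propagation speed into a
   bound by the barrier itself. *)
Lemma jbracket_dbarrier c T m z :
  jbracket z.2 * enorm (dbarrier c T m z) <= 2 * m.+1%:R * barrier c T m z.
Proof.
have s0 : 0 <= 1 + sqn z.2 by rewrite addr_ge0 ?sqn_ge0.
rewrite /dbarrier enormZ ger0_norm; last by rewrite !mulr_ge0 ?expR_ge0 ?exprn_ge0.
rewrite /barrier exprS.
set e := expR _; set P := _ ^+ m.
have h : jbracket z.2 * enorm z.2 <= 1 + sqn z.2.
  rewrite -jbracket_sqr expr2 ler_wpM2l ?jbracket_ge0//; exact: enorm_le_jbracket.
rewrite [leLHS](_ : _ = 2 * m.+1%:R * (e * P) * (jbracket z.2 * enorm z.2)); last by ring.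
rewrite [leRHS](_ : _ = 2 * m.+1%:R * (e * P) * (1 + sqn z.2)); last by ring.
by rewrite ler_wpM2l// !mulr_ge0 ?expR_ge0 ?exprn_ge0.
Qed.

(* Differentiate [phi] at [(t, x)] in the direction [(0, - p)]. *)
Lemma gradient_bound (T : R) (f phi : E -> R) (a L : R) dphi p t x :
  has_C1_diff phi dphi -> dphi (t, x) = pairing a p ->
  local_max_on (strip T) (fun z => f z - phi z) (t, x) -> 0 <= L ->
  (forall y, enorm (x - y) <= 1 -> f (t, x) - f (t, y) <= L * enorm (x - y)) ->
  enorm p <= L.
Proof.
move=> phid dphiE [[tT _] maxf] L0 fL.
pose w : E := (0, - p).
have Dw : 'D_w phi (t, x) = - sqn p.
  by rewrite (has_C1_diff_derive _ _ phid) dphiE /pairing/= mulr0 add0r dotvN dotvv.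
have dw : derivable phi (t, x) w.
  by apply: diff_derivable; case: phid => /(_ (t, x)) [].
have cw : (fun h : R => h *: w + (t, x)) @ 0^'+ --> ((t, x) : E).
  have h : continuous (fun h : R => h *: w + (t, x)).
    by move=> h; apply: cvgD; [exact: scalel_continuous | exact: cst_continuous].
  have := h 0; rewrite /continuous_at scale0r add0r.
  exact: cvg_at_right_filter.
(* At a maximum of [f - phi] the increment of [phi] dominates that of [f], which along [- h *: p] is
   at least [- L * h * enorm p]. Dividing by [h] and letting [h] tend to 0 from the right gives the
   bound. *)
have ge : - (L * enorm p) <= 'D_w phi (t, x).
  have cvD : (fun h : R => h^-1 *: (phi (h *: w + (t, x)) - phi (t, x))) @ 0^'+
      --> 'D_w phi (t, x) := cvg_dnbhs_at_right dw.
  have maxw : \forall h \near 0^'+, strip T (h *: w + (t, x)) ->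
      f (h *: w + (t, x)) - phi (h *: w + (t, x)) <= f (t, x) - phi (t, x) :=
    cw _ maxf.
  apply: (cvgr_to_ge cvD); near=> h.
  have h0 : 0 < h by near: h; exact: nbhs_right_gt.
  have hp1 : h * enorm p <= 1.
    (* This threshold keeps the displacement [h *: p] in the unit ball, where the Lipschitz bound on
       [f] is available. *)
    have : h < (1 + enorm p)^-1.
      near: h; apply: nbhs_right_lt.
      by rewrite invr_gt0 ltr_wpDr// enorm_ge0.
    move/ltW => hle; rewrite (le_trans (ler_wpM2r (enorm_ge0 p) hle))//.
    by rewrite ler_pdivrMl ?ltr_wpDr ?enorm_ge0// mulr1 lerDr.
  have wE : h *: w + (t, x) = (t, x - h *: p).
    by congr pair; rewrite /= ?scaler0 ?add0r// scalerN addrC.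
  have max_h : f (t, x - h *: p) - phi (t, x - h *: p) <= f (t, x) - phi (t, x).
    rewrite -wE; have : strip T (h *: w + (t, x)) by rewrite wE.
    by near: h; exact: maxw.
  have xE : x - (x - h *: p) = h *: p by rewrite opprB addrC subrK.
  have := fL (x - h *: p); rewrite xE enormZ (ger0_norm (ltW h0)) => /(_ hp1) fh.
  rewrite wE ler_pdivlMl//; lra.
rewrite Dw lerN2 -enorm_sqr expr2 in ge.
have [p0|p0] := eqVneq (enorm p) 0; first by rewrite p0.
by rewrite -(@ler_pM2r _ (enorm p))// lt_def p0 enorm_ge0.
Unshelve. all: end_near. Qed.

End test_functions.

Lemma continuous_within_comp (X Y Z : topologicalType) (A : set Y)
    (f : Y -> Z) (g : X -> Y) :
  {within A, continuous f} -> continuous g -> (forall x, A (g x)) ->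
  continuous (f \o g).
Proof.
move=> /subspace_continuousP cf cg gA x B /= /(cf _ (gA x)) /= fB.
have gB : \forall u \near x, A (g u) -> B (f (g u)) := cg x _ fB.
have : \forall u \near x, B (f (g u)) by apply: filterS gB => u /(_ (gA u)).
by [].
Qed.

(** * Doubling of variables *)

(* Clamping the time variable turns functions continuous on the closed strip
   into globally continuous ones. *)
Section clamp.
Variables (R : realType) (T : R).
Hypothesis T0 : 0 <= T.

Definition clamp (t : R) : R := Num.max 0 (Num.min T t).

Lemma clamp_itv t : 0 <= clamp t <= T.
Proof. by rewrite le_max lexx ge_max T0 ge_min lexx. Qed.

Lemma clamp_id t : 0 <= t <= T -> clamp t = t.
Proof. by move=> /andP[t0 tT]; rewrite /clamp min_r// max_r. Qed.

Lemma continuous_clamp : continuous clamp.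
Proof.
move=> t; apply: continuous_max; first exact: cst_continuous.
by apply: continuous_min; [exact: cst_continuous | exact: cvg_id].
Qed.

Lemma continuous_clamp_strip n (f : R -> 'rV[R]_n -> R) :
  {within strip T, continuous (fun z : R * 'rV[R]_n => f z.1 z.2)} ->
  continuous (fun z : R * 'rV[R]_n => f (clamp z.1) z.2).
Proof.
move=> cf.
apply: (@continuous_within_comp _ _ _ (strip T) _
  (fun z : R * 'rV[R]_n => (clamp z.1, z.2)) cf).
- move=> z; have cz : (fun z : R * 'rV[R]_n => clamp z.1) @ z --> clamp z.1.
    apply: (@continuous_comp _ _ _ fst clamp); first exact: cvg_fst.
    exact: continuous_clamp.
  exact: (cvg_pair cz (cvg_snd : snd @ z --> z.2)).
- by move=> z; split=> //=; rewrite in_itv/= clamp_itv.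
Qed.

Lemma continuous_clamp_strip2 n (f : R -> 'rV[R]_n -> 'rV[R]_n -> R) :
  {within `[0, T]%classic `*` setT `*` setT,
    continuous (fun z : R * 'rV[R]_n * 'rV[R]_n => f z.1.1 z.1.2 z.2)} ->
  continuous (fun z : R * 'rV[R]_n * 'rV[R]_n => f (clamp z.1.1) z.1.2 z.2).
Proof.
set E := (R * 'rV[R]_n * 'rV[R]_n)%type => cf.
apply: (@continuous_within_comp _ _ _ _ _
  (fun z : E => (clamp z.1.1, z.1.2, z.2)) cf) => z.
  have z1 : (fun z : E => clamp z.1.1) @ z --> clamp z.1.1.
    apply: (@continuous_comp _ _ _ (fun z : E => z.1.1) clamp).
      by apply: (@continuous_comp _ _ _ fst fst); exact: cvg_fst.
    exact: continuous_clamp.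
  have z2 : (fun z : E => z.1.2) @ z --> z.1.2.
    by apply: (@continuous_comp _ _ _ fst snd); [exact: cvg_fst|exact: cvg_snd].
  exact: (cvg_pair (cvg_pair z1 z2) (cvg_snd : snd @ z --> z.2)).
by split=> //=; split=> //=; rewrite in_itv/= clamp_itv.
Qed.

End clamp.

Section doubling.
Variables (R : realType) (n : nat).
Local Notation E := (R * 'rV[R]_n)%type.

Lemma sqdist_ge0 s y (z : E) : 0 <= sqdist s y z.
Proof. by rewrite addr_ge0 ?sqr_ge0 ?sqn_ge0. Qed.

Lemma sqdistC (z w : E) : sqdist w.1 w.2 z = sqdist z.1 z.2 w.
Proof. by rewrite /sqdist sqnC; congr (_ + _); ring. Qed.

Lemma sqdistxx (z : E) : sqdist z.1 z.2 z = 0.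
Proof. by rewrite /sqdist !subrr expr0n -enorm_sqr enorm0 expr0n addr0. Qed.

Lemma sqdist_lt (z w : E) d : 0 < d -> sqdist w.1 w.2 z < d ^+ 2 ->
  `|z.1 - w.1| < d /\ enorm (z.2 - w.2) < d.
Proof.
move=> d0; rewrite /sqdist => h.
have h1 := sqr_ge0 (z.1 - w.1); have h2 := sqn_ge0 (z.2 - w.2).
split; rewrite -ltr_sqr ?nnegrE ?enorm_ge0 ?(ltW d0)//.
  rewrite real_normK ?num_real//; lra.
rewrite enorm_sqr; lra.
Qed.

Lemma sqdist_ball (z w : E) d : 0 < d -> sqdist w.1 w.2 z < d ^+ 2 -> ball z d w.
Proof.
move=> d0 /(sqdist_lt d0)[h1 h2]; split; rewrite -ball_normE//=.
exact: le_lt_trans (norm_le_enorm _) h2.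
Qed.

Lemma continuous_sqdist : continuous (fun zw : E * E => sqdist zw.2.1 zw.2.2 zw.1).
Proof.
have c1 : continuous (fun zw : E * E => zw.1.1 - zw.2.1).
  move=> zw; apply: cvgB.
    by apply: (@continuous_comp _ _ _ fst fst); exact: cvg_fst.
  by apply: (@continuous_comp _ _ _ snd fst); [exact: cvg_snd | exact: cvg_fst].
have c2 : continuous (fun zw : E * E => zw.1.2 - zw.2.2).
  move=> zw; apply: cvgB.
    by apply: (@continuous_comp _ _ _ fst snd); [exact: cvg_fst | exact: cvg_snd].
  by apply: (@continuous_comp _ _ _ snd snd); exact: cvg_snd.
move=> zw; apply: cvgD.
  apply: (@continuous_comp _ _ _ (fun zw : E * E => zw.1.1 - zw.2.1)
    (fun r => r ^+ 2)); first exact: c1.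
  exact: exprn_continuous.
apply: (@continuous_comp _ _ _ (fun zw : E * E => zw.1.2 - zw.2.2) (@sqn R n)).
  exact: c2.
exact: continuous_sqn.
Qed.

(* [a] is large enough for the penalty to be smaller than the scales of uniform
   continuity of [v] and [w] at level [v z0 - w z0]; a maximum point with one
   entry in [bad] would then have a value below that at [(z0, z0)]. *)
Lemma doubling (v w : E -> R) (A bad : set E) (z0 : E) (d : R) :
  compact A -> continuous v -> continuous w -> A z0 -> w z0 < v z0 ->
  (forall z, A z -> bad z -> v z <= w z) -> 0 < d ->
  exists a : R, exists z1 z2 : E,
    [/\ 0 < a, A z1 /\ ~ bad z1, A z2 /\ ~ bad z2,
        sqdist z2.1 z2.2 z1 < d ^+ 2
      & (forall z, A z ->
           v z - a * sqdist z2.1 z2.2 z <= v z1 - a * sqdist z2.1 z2.2 z1) /\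
        (forall z, A z ->
           w z2 + a * sqdist z1.1 z1.2 z2 <= w z + a * sqdist z1.1 z1.2 z)].
Proof.
move=> cA cv cw Az0 wv badA d0.
pose e := v z0 - w z0; have e0 : 0 < e by rewrite subr_gt0.
have [dv dv0 ucv] := compact_uniform_continuous cA cv e0.
have [dw dw0 ucw] := compact_uniform_continuous cA cw e0.
pose r := Num.min d (Num.min dv dw).
have r0 : 0 < r by rewrite !lt_min d0 dv0 dw0.
have rd : r <= d by rewrite ge_min lexx.
have rv : r <= dv by rewrite !ge_min lexx orbT.
have rw : r <= dw by rewrite !ge_min lexx !orbT.
have cAA := compact_setX cA cA.
have AA0 : (A `*` A) !=set0 by exists (z0, z0).
have cvw : continuous (fun zw : E * E => v zw.1 - w zw.2).
  move=> zw; apply: cvgB.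
    by apply: (@continuous_comp _ _ _ fst v); [exact: cvg_fst | exact: cv].
  by apply: (@continuous_comp _ _ _ snd w); [exact: cvg_snd | exact: cw].
have [zM _ maxM] := compact_EVT_max AA0 cAA (continuous_subspaceT cvw).
pose M := v zM.1 - w zM.2.
have vwM z z' : A z -> A z' -> v z - w z' <= M.
  by move=> Az Az'; apply: (maxM (z, z')); rewrite inE.
have M0 : 0 < M by rewrite (lt_le_trans e0)// vwM.
(* At the maximum point the penalty is at most [M - e < 2 * M], which for this [a] forces the
   squared distance below [r ^+ 2]. *)
pose a := 2 * M / r ^+ 2.
have a0 : 0 < a by rewrite divr_gt0 ?exprn_gt0 ?mulr_gt0.
have cP : continuous (fun zw : E * E =>
    v zw.1 - w zw.2 - a * sqdist zw.2.1 zw.2.2 zw.1).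
  move=> zw; apply: cvgB; first exact: cvw.
  by apply: cvgMr; exact: continuous_sqdist.
have [[z1 z2] ] := compact_EVT_max AA0 cAA (continuous_subspaceT cP).
rewrite inE => -[/= A1 A2] maxP.
have maxzz z z' : A z -> A z' -> v z - w z' - a * sqdist z'.1 z'.2 z <=
    v z1 - w z2 - a * sqdist z2.1 z2.2 z1.
  by move=> Az Az'; apply: (maxP (z, z')); rewrite inE.
have P0 := maxzz _ _ Az0 Az0; rewrite sqdistxx mulr0 subr0 -/e in P0.
have sq0 := sqdist_ge0 z2.1 z2.2 z1.
have asq0 : 0 <= a * sqdist z2.1 z2.2 z1 by rewrite mulr_ge0// ltW.
have sqr : sqdist z2.1 z2.2 z1 < r ^+ 2.
  have : a * sqdist z2.1 z2.2 z1 < 2 * M by have := vwM _ _ A1 A2; lra.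
  by rewrite -ltr_pdivlMl// /a invf_div divfK// mulf_neq0// gt_eqF.
have b12 : ball z1 r z2 by exact: sqdist_ball.
exists a, z1, z2; split=> //.
(* If [z1] were bad, then [v z1 <= w z1 < w z2 + e], against [e <= v z1 - w z2] from [P0]. For [z2]
   the modulus of [v] is used instead. *)
- split=> // b1; have := badA _ A1 b1; have := ucw _ _ A1 (le_ball rw b12).
  by rewrite ltr_norml => /andP[_]; lra.
- split=> // b2; have := badA _ A2 b2; have := ucv _ _ A1 (le_ball rv b12).
  by rewrite ltr_norml => /andP[_]; lra.
- by rewrite (lt_le_trans sqr)// ler_sqr ?nnegrE// ltW.
- split=> z Az; first by have := maxzz _ _ Az A2; lra.
  by have := maxzz _ _ A1 Az; rewrite !(sqdistC z1); lra.
Qed.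

End doubling.

(** * Growth estimates *)

Section estimates.
Variables (R : realType) (n : nat).
Implicit Types x y p q : 'rV[R]_n.

Definition lipschitz_growth (K mu : R) (f : 'rV[R]_n -> R) :=
  forall x y, `|f x - f y| <=
    K * Num.max (jbracket x) (jbracket y) `^ (mu - 1) * enorm (x - y).

(** Within unit distance the two brackets are comparable, so the weight can be taken at [x] alone,
    at the cost of 2^(mu - 1). *)
Lemma lipschitz_growth_near K mu f x y :
  0 < K -> 1 <= mu -> lipschitz_growth K mu f -> enorm (x - y) <= 1 ->
  `|f x - f y| <= K * 2 `^ (mu - 1) * jbracket x `^ (mu - 1) * enorm (x - y).
Proof.
move=> K0 mu1 fK xy1; apply: (le_trans (fK x y)).
rewrite ler_wpM2r ?enorm_ge0// -mulrA ler_wpM2l ?(ltW K0)//.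
rewrite -powRM ?jbracket_ge0// ge0_ler_powR ?subr_ge0 ?nnegrE//.
- by rewrite le_max jbracket_ge0.
- by rewrite mulr_ge0 ?jbracket_ge0.
- by rewrite ge_max (jbracket_near xy1) andbT ler_peMl ?jbracket_ge0 ?ler1n.
Qed.

(** Comparison with the origin gives <x>^(mu - 1)|x| <= <x>^mu; rounding the exponent up to an
    integer prepares the comparison with the barrier. *)
Lemma lipschitz_growth_bound K mu f x (m : nat) :
  0 < K -> 1 <= mu -> mu <= m%:R -> lipschitz_growth K mu f ->
  `|f x| <= (`|f 0| + K) * jbracket x ^+ m.
Proof.
move=> K0 mu1 mum fK.
have jm1 : 1 <= jbracket x ^+ m by rewrite exprn_ege1 ?jbracket_ge1.
have fx0 : `|f x - f 0| <= K * jbracket x ^+ m.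
  apply: (le_trans (fK x 0)).
  rewrite -mulrA ler_wpM2l ?(ltW K0)// jbracket0 max_l ?jbracket_ge1// subr0.
  apply: (@le_trans _ _ (jbracket x `^ mu)).
    rewrite -[leRHS](mulr_powRB1 (jbracket_ge0 x) (lt_le_trans ltr01 mu1)) mulrC.
    by rewrite ler_wpM2r ?powR_ge0// enorm_le_jbracket.
  by rewrite -powR_mulrn ?jbracket_ge0// ler_powR ?jbracket_ge1.
have -> : f x = (f x - f 0) + f 0 by ring.
rewrite (le_trans (ler_normD _ _))// mulrDl addrC lerD// ler_peMr//.
Qed.

(* For gradients of size [L <x>^(mu - 1)] the condition on the exponents makes
   the Lipschitz constant of the Hamiltonian linear in [<x>]. *)
Lemma hamiltonian_increment (k : nat) (lambda nu : 'I_k -> R) (mu L : R) x p q :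
  1 <= mu -> 0 <= L ->
  (forall i, 0 <= nu i) -> (forall i, lambda i + (mu - 1) * nu i <= 1) ->
  enorm p <= L * jbracket x `^ (mu - 1) ->
  enorm q <= L * jbracket x `^ (mu - 1) ->
  \sum_(i < k) (jbracket x `^ lambda i *
     Num.max (enorm p) (enorm q) `^ nu i * enorm (p - q)) <=
  (\sum_(i < k) L `^ nu i) * (jbracket x * enorm (p - q)).
Proof.
move=> mu1 L0 nu0 lnu pL qL; rewrite mulr_suml; apply: ler_sum => i _.
rewrite mulrA ler_wpM2r ?enorm_ge0//.
have j0 := jbracket_gt0 x.
apply: (@le_trans _ _ (jbracket x `^ lambda i *
    (L `^ nu i * jbracket x `^ ((mu - 1) * nu i)))).
  rewrite ler_wpM2l ?powR_ge0// powRrM -powRM ?powR_ge0//.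
  rewrite ge0_ler_powR ?nnegrE ?mulr_ge0 ?powR_ge0 ?nu0//.
    by rewrite le_max enorm_ge0.
  by rewrite ge_max pL qL.
(* The powers of [jbracket x] combine into the exponent [lambda i + (mu - 1) * nu i], at most 1, and
   [jbracket x >= 1]. *)
rewrite mulrCA -powRD; last by rewrite (gt_eqF j0) implybT.
rewrite ler_wpM2l ?powR_ge0// -[leRHS]powRr1 ?(ltW j0)//.
by rewrite ler_powR ?jbracket_ge1.
Qed.

(** The values at the origin are bounded over the compact interval [0,T], which makes the growth
    constant uniform in time. *)
Lemma strip_growth_bound (T K mu : R) (f : R -> 'rV[R]_n -> R) (m : nat) :
  0 <= T -> 0 < K -> 1 <= mu -> mu <= m%:R ->
  {within strip T, continuous (fun z : R * 'rV[R]_n => f z.1 z.2)} ->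
  (forall t, 0 <= t <= T -> lipschitz_growth K mu (f t)) ->
  exists M, forall t x, 0 <= t <= T -> `|f t x| <= M * jbracket x ^+ m.
Proof.
move=> T0 K0 mu1 mum cf fK; pose g t := `|f (clamp T t) 0|.
have cg : continuous g.
  move=> t; apply: cvg_norm.
  apply: (@continuous_comp _ _ _ (fun t : R => (t, 0 : 'rV[R]_n))
    (fun z : R * 'rV[R]_n => f (clamp T z.1) z.2)).
    exact: (cvg_pair (cvg_id : id @ t --> t) (cvg_cst _)).
  exact: continuous_clamp_strip.
have I0 : `[0, T]%classic !=set0 by exists 0; rewrite /= in_itv/= lexx.
have [t1 _ maxt1] := compact_EVT_max I0 (@segment_compact R 0 T)
  (continuous_subspaceT cg).
exists (g t1 + K) => t x tT.
apply: le_trans (lipschitz_growth_bound x K0 mu1 mum (fK t tT)) _.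
rewrite ler_wpM2r ?exprn_ge0 ?jbracket_ge0// lerD2r.
by have := maxt1 t; rewrite inE /= in_itv/= /g clamp_id//; exact.
Qed.

End estimates.

(** * Comparison of the sub-solution with the super-solution *)

Theorem theorem4p3 (R : realType) (n k : nat) (T : R)
    (H : R -> 'rV[R]_n -> 'rV[R]_n -> R) (h : 'rV[R]_n -> R)
    (K0 mu : R) (lambda nu : 'I_k -> R) (omega : R -> R -> R -> R)
    (V Vhat : R -> 'rV[R]_n -> R) (K : R) :
  0 < T ->
  {within `[0, T]%classic `*` setT `*` setT,
    continuous (fun z : R * 'rV[R]_n * 'rV[R]_n => H z.1.1 z.1.2 z.2)} ->
  continuous h ->
  0 < K0 ->
  1 <= mu ->
  (forall i, 0 <= lambda i) ->
  (forall i, 0 <= nu i) ->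
  (forall i, lambda i + (mu - 1) * nu i <= 1) ->
  {within `[0, +oo[%classic `*` `[0, +oo[%classic `*` `[0, +oo[%classic,
    continuous (fun z : R * R * R => omega z.1.1 z.1.2 z.2)} ->
  (forall r s d, 0 <= r -> 0 <= s -> 0 <= d -> 0 <= omega r s d) ->
  (forall r s, 0 <= r -> 0 <= s -> omega r s 0 = 0) ->
  (forall t x y p, 0 <= t <= T ->
    `|H t x p - H t y p| <=
      omega (enorm x + enorm y) (enorm p) (enorm (x - y))) ->
  (forall t x p q, 0 <= t <= T ->
    `|H t x p - H t x q| <=
      K0 * \sum_(i < k) (jbracket x `^ lambda i *
        Num.max (enorm p) (enorm q) `^ nu i * enorm (p - q))) ->
  (forall x y,
    `|h x - h y| <=
      K0 * Num.max (jbracket x) (jbracket y) `^ (mu - 1) * enorm (x - y)) ->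
  viscosity_subsolution T H h V ->
  viscosity_supersolution T H h Vhat ->
  0 < K ->
  (forall t x y, 0 <= t <= T ->
    `|V t x - V t y| <=
      K * Num.max (jbracket x) (jbracket y) `^ (mu - 1) * enorm (x - y)) ->
  (forall t x y, 0 <= t <= T ->
    `|Vhat t x - Vhat t y| <=
      K * Num.max (jbracket x) (jbracket y) `^ (mu - 1) * enorm (x - y)) ->
  forall t x, 0 <= t <= T -> V t x <= Vhat t x.
Proof.
move=> T0 cH _ K0_gt0 mu1 _ nu0 lnu _ _ _ _ HL _.
move=> [cV VT subV] [cVh VhT supV] K_gt0 VK VhK.
suff main (t0 : R) x0 : 0 <= t0 <= T -> ~ Vhat t0 x0 < V t0 x0.
  by move=> t x tT; rewrite leNgt; apply/negP; exact: main.
move=> t0T VVh.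
have T0' := ltW T0.
pose v (z : R * 'rV[R]_n) := V (clamp T z.1) z.2.
pose w (z : R * 'rV[R]_n) := Vhat (clamp T z.1) z.2.
have cv : continuous v := continuous_clamp_strip T0' cV.
have cw : continuous w := continuous_clamp_strip T0' cVh.
pose m := Num.bound mu.
have mum : mu <= m.+1%:R.
  by rewrite (le_trans (ltW (archi_boundP _)))// ?(le_trans ler01)// ler_nat.
have VG t : 0 <= t <= T -> lipschitz_growth K mu (V t) by move=> tT x y; exact: VK.
have VhG t : 0 <= t <= T -> lipschitz_growth K mu (Vhat t).
  by move=> tT x y; exact: VhK.
pose L := K * 2 `^ (mu - 1).
have L0 : 0 < L by rewrite mulr_gt0// powR_gt0.
(* The constant in the bound C <x> for the Lipschitz constant of [H] in its last argument, for
   gradients up to 2L <x>^(mu - 1): the penalty gradient [p] below is controlled with 2L, and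
   [p + q] with L. *)
pose C := K0 * \sum_(i < k) (2 * L) `^ nu i.
have C0 : 0 <= C.
  by rewrite mulr_ge0 ?(ltW K0_gt0)// sumr_ge0// => i _; exact: powR_ge0.
(* By [jbracket_dbarrier], C <x> |psi_x| <= (c - 1) psi; the extra 1 leaves the strict gain -
   psi. *)
pose c := 2 * m.+1%:R * C + 1.
have c0 : 0 <= c by rewrite addr_ge0//; apply: mulr_ge0 => //; apply: mulr_ge0.
pose psi : R * 'rV[R]_n -> R := @barrier R n c T m.
have dpsi := has_C1_diff_barrier n c T m : has_C1_diff psi _.
have cpsi : continuous psi := has_C1_diff_continuous dpsi.
have psi1 t x : 0 <= t <= T -> 1 <= psi (t, x).
  by move=> /andP[_ tT]; exact: barrier_ge1.
(* [al] is so small that [u = V - al psi] still exceeds [Vhat] at [(t0, x0)]. *)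
pose al := (V t0 x0 - Vhat t0 x0) / (2 * psi (t0, x0)).
have psi00 : 0 < psi (t0, x0) by rewrite (lt_le_trans ltr01)// psi1.
have al0 : 0 < al by apply: divr_gt0; [rewrite subr_gt0 | exact: mulr_gt0].
pose u z := v z - al * psi z.
have cu : continuous u.
  by move=> z; apply: cvgB; [exact: cv | apply: cvgMr; exact: cpsi].
have wu0 : w (t0, x0) < u (t0, x0).
  have alE : al * psi (t0, x0) = (V t0 x0 - Vhat t0 x0) / 2.
    by rewrite /al; field; rewrite gt_eqF.
  by rewrite /u /v /w/= clamp_id// alE; lra.
have [M1 VM1] := strip_growth_bound T0' K_gt0 mu1 mum cV VG.
have [M2 VhM2] := strip_growth_bound T0' K_gt0 mu1 mum cVh VhG.
pose M := M1 + M2.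
have vwM t x : 0 <= t <= T -> V t x - Vhat t x <= M * jbracket x ^+ m.+1.
  move=> tT; have := VM1 t x tT; have := VhM2 t x tT.
  by rewrite !ler_norml mulrDl => /andP[h1 _] /andP[_ h2]; lra.
(* The first entry puts [x0] in the ball; the second gives [M <= al * jbracket x] on and outside its
   sphere. *)
pose r := Num.max (enorm x0 + 1) (M / al).
pose A := [set z : R * 'rV[R]_n | 0 <= z.1 <= T /\ enorm z.2 <= r].
(* The face t = 0 is not included: the viscosity inequalities hold there as well. *)
pose bad := [set z : R * 'rV[R]_n | z.1 = T \/ r <= enorm z.2].
have cA : compact A.
  rewrite (_ : A = `[0, T]%classic `*` [set x : 'rV[R]_n | enorm x <= r]).
    by apply: compact_setX; [exact: segment_compact | exact: compact_eball].
  by apply/seteqP; split=> z /=; rewrite in_itv.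
have A0 : A (t0, x0) by split=> //=; rewrite le_max lerDl ler01.
have badA z : A z -> bad z -> u z <= w z.
  case: z => t x [/= tT xr] bz.
  have p1 := psi1 t x tT.
  rewrite /u /v /w/= clamp_id//.
  case: bz => /= [tE | rx].
    rewrite tE; have := VT x; have := VhT x; have : 0 <= al * psi (T, x).
      by rewrite -tE mulr_ge0 ?(ltW al0) ?(le_trans ler01).
    lra.
  suff : M * jbracket x ^+ m.+1 <= al * psi (t, x) by have := vwM t x tT; lra.
  have j1 := jbracket_ge1 x; have j0 := jbracket_ge0 x.
  (* [psi] dominates a product of two factors [jbracket x ^+ m.+1]: one absorbs [M / al], the other
     matches the growth of [V - Vhat]. *)
  have Mj : M <= al * jbracket x ^+ m.+1.
    rewrite -ler_pdivrMl// mulrC; apply: (@le_trans _ _ (jbracket x)).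
      apply: (@le_trans _ _ r); first by rewrite le_max lexx orbT.
      exact: le_trans rx (enorm_le_jbracket x).
    by rewrite exprS ler_peMr// exprn_ege1.
  apply: (le_trans (ler_wpM2r (exprn_ge0 _ j0) Mj)).
  rewrite -mulrA ler_wpM2l ?(ltW al0)// /psi /barrier/= -jbracket_sqr.
  rewrite -exprMn -expr2 ler_peMl ?exprn_ge0//.
  by rewrite -[leLHS]expR0 ler_expR mulr_ge0 ?subr_ge0//; case/andP: tT.
(* [J] bounds the bracket on the ball, so [P0] bounds [p] whatever the penalty parameter. Thus the
   compact set [B] and the modulus [d] of [H] can be fixed before [a] is known. *)
pose J := Num.sqrt (1 + r ^+ 2).
pose P0 := 2 * L * J `^ (mu - 1).
pose B := (`[0, T]%classic `*` [set x : 'rV[R]_n | enorm x <= r]) `*`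
  [set p : 'rV[R]_n | enorm p <= P0].
have cB : compact B.
  apply: compact_setX; last exact: compact_eball.
  by apply: compact_setX; [exact: segment_compact | exact: compact_eball].
have cHc := continuous_clamp_strip2 T0' cH.
have [d d0 Hd] := compact_uniform_continuous cB cHc al0.
(* The entry 1 ensures [enorm (x - y) <= 1], as [lipschitz_growth_near] requires. *)
have d10 : 0 < Num.min d 1 by rewrite lt_min d0 ltr01.
have [a [[t x] [[s y] [a0 [At badt] [As bads] ]]]] :=
  doubling cA cu cw A0 wu0 badA d10.
move: At As badt bads => [/= tT xr] [/= sT yr] badt bads sq [maxu minw].
(* Since both points lie strictly inside the ball, extrema over [A] are local extrema relative to
   the whole strip. *)
have near_eball t' x' : enorm x' < r ->
    \forall z \near nbhs ((t', x') : R * 'rV[R]_n), enorm z.2 < r.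
  move=> x'r.
  have ce : continuous (fun z : R * 'rV[R]_n => enorm z.2).
    move=> z; apply: (@continuous_comp _ _ _ snd (@enorm R n)).
      exact: cvg_snd.
    exact: continuous_enorm.
  by have /cvgr_lt := ce (t', x'); apply.
have [{}tlT xlr] : t < T /\ enorm x < r.
  split; last by rewrite ltNge; apply/negP => rx; apply: badt; right.
  rewrite lt_neqAle; case/andP: tT => _ ->; rewrite andbT.
  by apply/eqP => tE; apply: badt; left.
have [{}slT ylr] : s < T /\ enorm y < r.
  split; last by rewrite ltNge; apply/negP => rx; apply: bads; right.
  rewrite lt_neqAle; case/andP: sT => _ ->; rewrite andbT.
  by apply/eqP => sE; apply: bads; left.
have b12 : ball ((t, x) : R * 'rV[R]_n) d (s, y).
  have dd : Num.min d 1 <= d by rewrite ge_min lexx.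
  exact: le_ball dd _ (@sqdist_ball _ _ (t, x) (s, y) _ d10 sq).
have xy1 : enorm (x - y) <= 1.
  have [_ /ltW/le_trans] := @sqdist_lt _ _ (t, x) (s, y) _ d10 sq; apply.
  by rewrite ge_min lexx orbT.
pose p := (2 * a) *: (x - y).
pose q := al *: dbarrier c T m (t, x).
pose jm := jbracket x `^ (mu - 1).
have jm0 : 0 <= jm by exact: powR_ge0.
(* The minimum property at [y] compared with the competitor [x]. *)
have pL : enorm p <= 2 * L * jm.
  rewrite enormZ ger0_norm; last by rewrite mulr_ge0// ltW.
  have [xy0|xy0] := eqVneq (enorm (x - y)) 0.
    by rewrite xy0 mulr0 !mulr_ge0// ltW.
  have xy_gt0 : 0 < enorm (x - y) by rewrite lt_def xy0 enorm_ge0.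
  have := minw (s, x) (conj sT xr).
  (* The competitor keeps the time [s], so the time penalties cancel and a|x - y|^2 <= Vhat(s,x) -
     Vhat(s,y). *)
  rewrite /w/= clamp_id// /sqdist/= -!enorm_sqr subrr enorm0 (enormC y) => hmin.
  have := lipschitz_growth_near K_gt0 mu1 (VhG s sT) xy1.
  rewrite ler_norml => /andP[_ hlip].
  rewrite -/L -/jm in hlip; rewrite -(ler_pM2r xy_gt0).
  rewrite [leLHS](_ : _ = 2 * (a * enorm (x - y) ^+ 2)); last by ring.
  rewrite [leRHS](_ : _ = 2 * (L * jm * enorm (x - y))); last by ring.
  rewrite ler_pM2l//; lra.
pose phi z := a * sqdist s y z + al * psi z.
have dphi : has_C1_diff phi (fun z =>
    pairing (2 * a * (z.1 - s) + al * (- c * psi z))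
            ((2 * a) *: (z.2 - y) + al *: dbarrier c T m z)).
  apply: eq_has_C1_diff (has_C1_diffD (has_C1_diffZ a (has_C1_diff_sqdist s y))
    (has_C1_diffZ al dpsi)) _ => z z'.
  by rewrite /pairing /psi !dotvD !dotvZ; ring.
have maxphi : local_max_on (strip T) (fun z => V z.1 z.2 - phi z) (t, x).
  split; first by split=> //=; rewrite in_itv.
  apply: filterS (near_eball _ _ xlr) => -[t' x'] /= /ltW x'r [/= + _].
  rewrite in_itv/= => t'T; have := maxu (t', x') (conj t'T x'r).
  by rewrite /u /v /phi/= !clamp_id//; lra.
have sub := subV phi (has_C1_diff_C1 dphi) t x _ maxphi.
rewrite (partial_t_pairing _ _ dphi) (gradient_x_pairing _ _ dphi) in sub.
rewrite /= -/p -/q in sub.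
have pqL : enorm (p + q) <= L * jm.
  apply: (@gradient_bound _ _ T (fun z => V z.1 z.2) phi _ (L * jm) _ _ t x
    dphi erefl maxphi).
    by rewrite mulr_ge0// ltW.
  move=> y' /(lipschitz_growth_near K_gt0 mu1 (VG t tT)) /=.
  by rewrite ler_norml => /andP[_].
(* With this sign its gradient at [(s, y)] is again [p], and its time derivative 2a(t - s) is the
   penalty part of that of [phi] at [(t, x)]. *)
pose phih z := - a * sqdist t x z.
have dphih : has_C1_diff phih (fun z =>
    pairing (2 * a * (t - z.1)) ((2 * a) *: (x - z.2))).
  apply: eq_has_C1_diff (has_C1_diffZ (- a) (has_C1_diff_sqdist t x)) _ => z z'.
  by rewrite /pairing -(opprB z.2) scalerN -scaleNr !dotvZ; ring.
have minphih : local_min_on (strip T) (fun z => Vhat z.1 z.2 - phih z) (s, y).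
  split; first by split=> //=; rewrite in_itv.
  apply: filterS (near_eball _ _ ylr) => -[s' y'] /= /ltW y'r [/= + _].
  rewrite in_itv/= => s'T; have := minw (s', y') (conj s'T y'r).
  by rewrite /w /phih/= !clamp_id//; lra.
have sup := supV phih (has_C1_diff_C1 dphih) s y _ minphih.
rewrite (partial_t_pairing _ _ dphih) (gradient_x_pairing _ _ dphih) in sup.
rewrite /= -/p in sup.
have Hxp : H t x (p + q) - H t x p <= al * (c - 1) * psi (t, x).
  apply: (le_trans (ler_norm _)); apply: (le_trans (HL t x (p + q) p tT)).
  have pqL' : enorm (p + q) <= 2 * L * jm.
    by rewrite (le_trans pqL)// -mulrA ler_peMl ?ler1n// mulr_ge0// ltW.
  have LL0 : 0 <= 2 * L by rewrite mulr_ge0// ltW.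
  apply: (le_trans (ler_wpM2l (ltW K0_gt0)
    (hamiltonian_increment mu1 LL0 nu0 lnu pqL' pL))).
  rewrite [leLHS]mulrA -/C addrC addKr /q enormZ (ger0_norm (ltW al0)).
  have := ler_wpM2l (mulr_ge0 C0 (ltW al0)) (jbracket_dbarrier c T m (t, x)).
  rewrite -/psi /= => hdb; apply: le_trans (le_trans hdb _); first by lra.
  rewrite [leRHS](_ : _ = C * al * (2 * m.+1%:R * psi (t, x)))//.
  by rewrite /c; ring.
have HH : H t x p - H s y p < al.
  have Bxp : B ((t, x), p).
    split=> /=; first by split=> //=; rewrite in_itv.
    apply: le_trans pL _; rewrite ler_pM2l; last exact: mulr_gt0.
    rewrite ge0_ler_powR ?subr_ge0 ?nnegrE ?jbracket_ge0 ?sqrtr_ge0//.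
    by rewrite ler_sqrt ?addr_ge0 ?sqr_ge0// lerD2l ler_sqr ?nnegrE
      ?enorm_ge0 ?(le_trans (enorm_ge0 x)).
  have := Hd ((t, x), p) ((s, y), p) Bxp (conj b12 (ballxx _ d0)).
  by rewrite /= !clamp_id// ltr_norml => /andP[_].
have alpsi : al <= al * psi (t, x) by rewrite ler_peMr ?(ltW al0)// psi1.
have := sub _; have := sup _.
(* Subtracting the two viscosity inequalities cancels 2a(t - s); [Hxp] and [HH] then give 0 < - al
   psi + al, against [alpsi]. *)
rewrite tlT slT; case/andP: tT => -> _; case/andP: sT => -> _.
move=> /(_ isT) ss /(_ isT) st.
have : al * (c - 1) * psi (t, x) = al * c * psi (t, x) - al * psi (t, x) by ring.
rewrite mulrDr in st; lra.
Qed.
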